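(* Let $q$ be a prime power, $n\ge 1$, $G=\mathrm{GL}_n(\mathbb{F}_q)$, and $U\subseteq G$ the subgroup of upper unitriangular matrices. Fix a nontrivial character $\psi:(\mathbb{F}_q,+)\to\mathbb{C}^*$ and a composition $\mu=(\mu_1,\dots,\mu_\ell)$ of $n$. Let $N\subseteq G$ be the set of monomial matrices (exactly one nonzero entry in each row and column) and $$N_\mu=\{v\in N:\ \text{for all } u\in U \text{ with } vuv^{-1}\in U,\ \psi_\mu(u)=\psi_\mu(vuv^{-1})\}.$$ Then the map $M_\mu\to N_\mu$, $a\mapsto v_a$, is a bijection.
   Context: For $i\neq j$ and $t\in\mathbb{F}_q$, $x_{ij}(t)$ is the identity matrix with $t$ added in position $(i,j)$. Let $B_\mu=\{\mu_1,\mu_1+\mu_2,\dots,\mu_1+\dots+\mu_\ell\}$. The linear character $\psi_\mu:U\to\mathbb{C}^*$ is determined by $\psi_\mu(x_{ij}(t))=\psi(t)$ if $j=i+1$ and $i\notin B_\mu$, and $\psi_\mu(x_{ij}(t))=1$ for all other $i<j$. $M_\mu$ is the set of $\ell\times\ell$ matrices $a=(a_{ij})$ with entries monic polynomials $a_{ij}\in\mathbb{F}_q[X]$ with $a_{ij}(0)\neq0$, such that for every $i$, $\sum_{j}\deg a_{ij}=\mu_i$ and for every $j$, $\sum_i \deg a_{ij}=\mu_j$. For $k\ge1$ let $w_{(k)}$ be the $k\times k$ antidiagonal permutation matrix, $(w_{(k)})_{ij}=\delta_{j,k-i+1}$. For a monic $f=a_0+a_1X^{i_1}+\dots+a_rX^{i_r}+X^m\in\mathbb{F}_q[X]$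 with $0<i_1<\dots<i_r<m$ and $a_0,\dots,a_r\neq0$, set $v_{(f)}=w_{(m)}\,(a_0w_{(i_1)}\oplus a_1w_{(i_2-i_1)}\oplus\dots\oplus a_rw_{(m-i_r)})$ (block diagonal sum), an $m\times m$ matrix; by convention $v_{(1)}$ is the empty $0\times0$ matrix. For $a\in M_\mu$, $v_a$ is the $n\times n$ matrix defined as follows. Let $R_i=\mu_1+\dots+\mu_{i-1}$ and $d_{ij}=\deg a_{ij}$. For each $i,j$, place the $d_{ij}\times d_{ij}$ matrix $v_{(a_{ij})}$ in rows $R_i+\sum_{k>j}d_{ik}+1,\dots,R_i+\sum_{k\ge j}d_{ik}$ and columns $R_j+\sum_{k>i}d_{kj}+1,\dots,R_j+\sum_{k\ge i}d_{kj}$; all other entries of $v_a$ are $0$. (Thus within the $i$-th block of $\mu_i$ rows, the blocks $v_{(a_{i\ell})},\dots,v_{(a_{i1})}$ are stacked from top to bottom, and within the $j$-th block of $\mu_j$ columns, $v_{(a_{\ell j})},\dots,v_{(a_{1j})}$ appear from left to right.) *)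

(* Defs.v *)
From HB Require Import structures.
From mathcomp Require Import all_boot all_order all_algebra.
From mathcomp Require Import classical_sets functions.

Set Implicit Arguments.
Unset Strict Implicit.
Unset Printing Implicit Defensive.

Import GRing.Theory.
Local Open Scope ring_scope.

(* Mathematical Components, with sets as predicates from mathcomp.classical.
   Rows, columns and parts are indexed from 0 (ordinals): row i : 'I_n is the
   (i.+1)-th row. *)

Definition composition (n l : nat) (mu : 'I_l -> nat) : Prop :=
  (forall i, (0 < mu i)%N) /\ (\sum_i mu i)%N = n.

Definition partial_sums (l : nat) (mu : 'I_l -> nat) : seq nat :=
  [seq (\sum_(j < l | (j <= k)%N) mu j)%N | k : 'I_l].

(* Homomorphisms from (F, +) to the multiplicative group of C. *)
Definition additive_character (F : finFieldType) (C : numClosedFieldType)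
    (psi : F -> C) : Prop :=
  (forall x, psi x != 0) /\ (forall x y, psi (x + y) = psi x * psi y).

Definition nontrivial_character (F : finFieldType) (C : numClosedFieldType)
    (psi : F -> C) : Prop :=
  exists x, psi x != 1.

Definition unitriangular (F : finFieldType) (n : nat) : set 'M[F]_n :=
  fun u => forall i j : 'I_n, (j <= i)%N -> u i j = (i == j)%:R.

(* Homomorphisms from the unitriangular group to the multiplicative group of
   C; the values of chi outside that group are irrelevant. *)
Definition linear_character_U (F : finFieldType) (C : numClosedFieldType)
    (n : nat) (chi : 'M[F]_n -> C) : Prop :=
  (forall u, unitriangular u -> chi u != 0) /\
  (forall u v, unitriangular u -> unitriangular v ->
     chi (u *m v) = chi u * chi v).

Definition xij (F : finFieldType) (n : nat) (i j : 'I_n) (t : F) : 'M[F]_n :=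
  1%:M + t *: delta_mx i j.

(* Being a linear character of the unitriangular group with these values on
   the matrices xij determines psi_mu on that group; see is_psi_mu_exists and
   is_psi_mu_unique below. *)
Definition is_psi_mu (F : finFieldType) (C : numClosedFieldType) (psi : F -> C)
    (n l : nat) (mu : 'I_l -> nat) (psi_mu : 'M[F]_n -> C) : Prop :=
  linear_character_U psi_mu /\
  (forall (i j : 'I_n) (t : F), (i < j)%N ->
     psi_mu (xij i j t) =
       if (j == i.+1 :> nat) && (i.+1 \notin partial_sums mu)
       then psi t else 1).

Definition monomial_mx (F : finFieldType) (n : nat) (v : 'M[F]_n) : Prop :=
  (forall i, exists! j, v i j != 0) /\ (forall j, exists! i, v i j != 0).

Definition N_mu (F : finFieldType) (C : numClosedFieldType) (n : nat)
    (psi_mu : 'M[F]_n -> C) : set 'M[F]_n :=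
  fun v => [/\ v \in unitmx, monomial_mx v &
    forall u : 'M[F]_n, unitriangular u ->
      unitriangular (v *m u *m invmx v) ->
      psi_mu u = psi_mu (v *m u *m invmx v)].

Definition pdeg (F : finFieldType) (f : {poly F}) : nat := (size f).-1.

Definition M_mu (F : finFieldType) (l : nat) (mu : 'I_l -> nat) :
    set 'M[{poly F}]_l :=
  fun a => [/\ forall i j, a i j \is monic,
               forall i j, (a i j).[0] != 0,
               forall i, (\sum_j pdeg (a i j))%N = mu i &
               forall j, (\sum_i pdeg (a i j))%N = mu j].
Arguments M_mu F {l} mu.

Definition antidiag (F : finFieldType) (k : nat) : 'M[F]_k :=
  \matrix_(i, j) (j == rev_ord i)%:R.

(* The increasing list 0 < i_1 < ... < i_r < m of the exponents of f (when
   f is monic of degree m with nonzero constant term). *)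
Definition exponents (F : finFieldType) (f : {poly F}) : seq nat :=
  [seq i <- iota 0 (size f) | f`_i != 0].

Definition gap (F : finFieldType) (f : {poly F})
    (k : 'I_(size (exponents f)).-1) : nat :=
  (nth 0 (exponents f) k.+1 - nth 0 (exponents f) k)%N.

(* a_0 w_(i_1) (+) a_1 w_(i_2 - i_1) (+) ... (+) a_r w_(m - i_r) *)
Definition v_diag (F : finFieldType) (f : {poly F}) :
    'M[F]_(\sum_k gap (f := f) k) :=
  \mxdiag_k (f`_(nth 0%N (exponents f) k) *: antidiag F (gap (f := f) k)).

(* conform_mx only transports v_diag f along the equality of \sum_k gap k with
   pdeg f, which holds as soon as the constant term of f is nonzero (lemma
   sum_gap below). *)
Definition v_poly (F : finFieldType) (f : {poly F}) : 'M[F]_(pdeg f) :=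
  antidiag F (pdeg f) *m conform_mx 0 (v_diag f).

(* A sits in rows r, ..., r + d - 1 and columns c, ..., c + d - 1. *)
Definition place_block (F : finFieldType) (n r c d : nat) (A : 'M[F]_d) :
    'M[F]_n :=
  \matrix_(x, y) \sum_(s < d) \sum_(t < d)
     A s t *+ ((x == r + s :> nat)%N && (y == c + t :> nat)%N).
Arguments place_block {F} n r c {d} A.

Definition part_start (l : nat) (mu : 'I_l -> nat) (i : 'I_l) : nat :=
  (\sum_(k < l | (k < i)%N) mu k)%N.

Definition row_start (F : finFieldType) (l : nat) (mu : 'I_l -> nat)
    (a : 'M[{poly F}]_l) (i j : 'I_l) : nat :=
  (part_start mu i + \sum_(k < l | (j < k)%N) pdeg (a i k))%N.

Definition col_start (F : finFieldType) (l : nat) (mu : 'I_l -> nat)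
    (a : 'M[{poly F}]_l) (i j : 'I_l) : nat :=
  (part_start mu j + \sum_(k < l | (i < k)%N) pdeg (a k j))%N.

(* The blocks occupy pairwise disjoint sets of rows, so that the sum is a
   juxtaposition. *)
Definition v_mx (F : finFieldType) (n l : nat) (mu : 'I_l -> nat)
    (a : 'M[{poly F}]_l) : 'M[F]_n :=
  \sum_i \sum_j
    place_block n (row_start mu a i j) (col_start mu a i j) (v_poly (a i j)).
Arguments v_mx {F} n {l} mu a.

Lemma sum_gap (F : finFieldType) (f : {poly F}) :
  f.[0] != 0 -> (\sum_k gap (f := f) k)%N = pdeg f.
Proof.
rewrite horner_coef0 => f0.
have f_neq0 : f != 0 by apply: contraNneq f0 => ->; rewrite coef0.
have szf : size f = (pdeg f).+1 by rewrite prednK // lt0n size_poly_eq0.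
pose s := exponents f.
have s_sorted : sorted leq s.
  by apply: (sorted_filter leq_trans); exact: iota_sorted.
have s0 : nth 0%N s 0 = 0%N.
  by rewrite /s /exponents szf /= f0.
have s_last : last 0%N s = pdeg f.
  rewrite /s /exponents szf -[(pdeg f).+1]addn1 iotaD filter_cat /= add0n.
  by rewrite -lead_coefE lead_coef_eq0 f_neq0 last_cat.
rewrite /gap -/s -(big_mkord xpredT (fun k => nth 0 s k.+1 - nth 0 s k)%N).
rewrite telescope_sumn_in // ?s0 ?subn0 ?nth_last // => i /andP[_ lti].
by apply: (sorted_leq_nth leq_trans leqnn) => //;
  rewrite inE -?ltn_predRL // (leq_trans lti) // leq_pred.
Qed.

Lemma mulmx_xij (F : finFieldType) (n : nat) (u : 'M[F]_n) (i j : 'I_n) (t : F)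
    (k m : 'I_n) :
  (u *m xij i j t) k m = u k m + t * u k i *+ (m == j).
Proof.
rewrite mulmxDr mulmx1 -scalemxAr !mxE (bigD1 i) //= big1 => [|p /negPf pi].
  by rewrite mxE eqxx /= mulr_natr addr0 mulrnAr.
by rewrite mxE pi mulr0.
Qed.

Lemma unitriangular_xij (F : finFieldType) (n : nat) (i j : 'I_n) (t : F) :
  (i < j)%N -> unitriangular (xij i j t).
Proof.
move=> ij k m mk; rewrite -[xij _ _ _]mul1mx mulmx_xij !mxE.
case: (eqVneq m j) => [mj|_]; last by rewrite mulr0n addr0.
case: (eqVneq k i) => [ki|_]; last by rewrite mulr0 mul0rn addr0.
by move: mk; rewrite mj ki leqNgt ij.
Qed.

Lemma unitriangularM (F : finFieldType) (n : nat) (u v : 'M[F]_n) :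
  unitriangular u -> unitriangular v -> unitriangular (u *m v).
Proof.
move=> Uu Uv i j ji; rewrite mxE (bigD1 i) //= big1 => [|k ki].
  by rewrite Uu // eqxx mul1r addr0 Uv.
case: (ltnP i k) => [ik|ki'].
  rewrite (Uv k j); last exact: leq_trans ji (ltnW ik).
  by rewrite -val_eqE /= gtn_eqF ?mulr0 //; exact: leq_ltn_trans ji ik.
by rewrite Uu // eq_sym (negPf ki) mul0r.
Qed.

Lemma is_psi_mu_exists (F : finFieldType) (C : numClosedFieldType)
    (psi : F -> C) (n l : nat) (mu : 'I_l -> nat) :
  additive_character psi ->
  exists psi_mu : 'M[F]_n -> C, is_psi_mu psi mu psi_mu.
Proof.
move=> [psi_neq0 psiD].
have psi0 : psi 0 = 1.
  by apply: (mulfI (psi_neq0 0)); rewrite -psiD addr0 mulr1.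
pose P (i j : 'I_n) := (j == i.+1 :> nat) && (i.+1 \notin partial_sums mu).
exists (fun u => \prod_i \prod_(j | P i j) psi (u i j)); split; first split.
- by move=> u _; apply/prodf_neq0 => i _; apply/prodf_neq0.
- move=> u v Uu Uv; rewrite -big_split; apply: eq_bigr => i _ /=.
  rewrite -big_split; apply: eq_bigr => j /andP[/eqP ji _] /=.
  rewrite -psiD mxE; congr psi.
  have ij : i != j by rewrite -val_eqE /= ji ltn_eqF.
  rewrite (bigD1 i) //= (bigD1 j) /= 1?eq_sym // big1 => [|k /andP[ki kj]].
    by rewrite (Uu i i) // (Uv j j) // !eqxx mul1r mulr1 addr0 addrC.
  case: (ltnP i k) => [ik|ki']; last by rewrite Uu // eq_sym (negPf ki) mul0r.
  by rewrite (Uv k j) ?ji // (negPf kj) mulr0.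
move=> i j t ij.
have E k m : P k m -> psi (xij i j t k m) =
    if (k == i) && (m == j) then psi t else 1.
  move=> /andP[/eqP mk _].
  have km : k != m by rewrite -val_eqE /= mk ltn_eqF.
  rewrite !mxE (negPf km) add0r.
  by case: ifP => _; rewrite ?mulr1 ?mulr0.
rewrite (bigD1 i) //= [X in _ * X]big1 ?mulr1 => [|k /negPf ki]; last first.
  by rewrite big1 // => m Pkm; rewrite E // ki.
rewrite -/(P i j); case: ifP => Pij.
  rewrite (bigD1 j) //= E // !eqxx big1 ?mulr1 // => m /andP[Pim /negPf mj].
  by rewrite E // mj andbF.
rewrite big1 // => m Pim; rewrite E //; case: eqP => //= _.
by case: eqP => // mj; rewrite -mj Pim in Pij.
Qed.

Lemma is_psi_mu_unique (F : finFieldType) (C : numClosedFieldType)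
    (psi : F -> C) (n l : nat) (mu : 'I_l -> nat) (chi1 chi2 : 'M[F]_n -> C) :
  is_psi_mu psi mu chi1 -> is_psi_mu psi mu chi2 ->
  forall u, unitriangular u -> chi1 u = chi2 u.
Proof.
move=> [[neq01 chi1M] chi1E] [[neq02 chi2M] chi2E].
have U1 : unitriangular (1%:M : 'M[F]_n) by move=> i j _; rewrite mxE.
have chi1_1 : chi1 1%:M = 1.
  by apply: (mulfI (neq01 _ U1)); rewrite -chi1M // mulmx1 mulr1.
have chi2_1 : chi2 1%:M = 1.
  by apply: (mulfI (neq02 _ U1)); rewrite -chi2M // mulmx1 mulr1.
suff H m (u : 'M[F]_n) : unitriangular u ->
    (forall i j : 'I_n, (i < j)%N -> (m <= i * n + j)%N -> u i j = 0) ->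
    chi1 u = chi2 u.
  move=> u Uu; apply: (H (n * n)%N) => // i j _ le_nn.
  suff : (i * n + j < n * n)%N by rewrite ltnNge le_nn.
  by rewrite (@leq_trans (i.+1 * n)) ?leq_mul2r ?ltn_ord ?orbT // mulSn addnC
    ltn_add2r.
elim: m u => [|m IHm] u Uu u0.
  suff -> : u = 1%:M by rewrite chi1_1 chi2_1.
  apply/matrixP => i j; rewrite mxE; case: (leqP j i) => [/Uu //|ij].
  by rewrite u0 // -val_eqE /= ltn_eqF.
case: (pickP (fun p : 'I_n * 'I_n => (p.1 < p.2)%N && (p.1 * n + p.2 == m)%N))
    => [[i j] /= /andP[ij /eqP ijm]|noij]; last first.
  apply: IHm => // i j ij; rewrite leq_eqVlt => /orP[/eqP ijm|]; last exact: u0.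
  by have := noij (i, j); rewrite /= ij -ijm eqxx.
pose w := u *m xij i j (- u i j).
have Uw : unitriangular w by apply: unitriangularM => //; exact: unitriangular_xij.
have uE : u = w *m xij i j (u i j).
  apply/matrixP => k p; rewrite !mulmx_xij.
  by rewrite (ltn_eqF ij : (i == j) = false) mulr0n addr0 mulNr mulNrn addrNK.
have w0 : chi1 w = chi2 w.
  apply: IHm => // k p kp; rewrite leq_eqVlt mulmx_xij => le_m.
  case: (eqVneq p j) => [pj|pj]; last first.
    rewrite mulr0n addr0; apply: u0 => //; case/orP: le_m => // /eqP le_m.
    have n_gt0 : (0 < n)%N by case: (n) i {ij ijm w Uw uE} => [[]|].
    case/negP: pj; apply/eqP/val_inj => /=.
    have := congr1 (modn^~ n) (etrans ijm le_m).
    by rewrite !modnMDl !modn_small.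
  rewrite mulr1n; case: (ltngtP k i) => [ki|ik|/val_inj ki].
  - suff : (k * n + p < m)%N.
      by case/orP: le_m => [/eqP <-|lt_m /(ltn_trans lt_m)]; rewrite ltnn.
    rewrite -ijm pj ltn_add2r ltn_mul2r ki andbT.
    by case: (n) i {ij ijm w Uw uE ki} => [[]|].
  - rewrite (Uu k i) ?(ltnW ik) // -val_eqE /= gtn_eqF // mulr0 addr0.
    apply: u0 => //; rewrite -ijm pj ltn_add2r ltn_mul2r ik andbT.
    by case: (n) i {ij ijm w Uw uE ik} => [[]|].
  - by rewrite ki pj (Uu i i) // eqxx mulr1 addrN.
have Ux : unitriangular (xij i j (u i j)) by exact: unitriangular_xij.
by rewrite uE (chi1M _ _ Uw Ux) (chi2M _ _ Uw Ux) w0 chi1E ?chi2E.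
Qed.

(* Main.v *)
(* Conjugating a root subgroup by a monomial matrix v with nonzero entries at
   (x, s) and (y, t), where x < y and s < t, turns x_st into x_xy.  Hence v lies
   in N_mu exactly when, for all such entries, if one of the pairs (x, y), (s, t)
   consists of consecutive indices in one block of mu, then so does the other,
   and the two entries are equal.
   From one column of a block to the next, the row of the nonzero entry thus
   either goes down by one, within a block of rows and with the same entry, or
   strictly goes up; such a sequence is a concatenation of runs of consecutive
   rows in which every run lies above all the previous ones.  So the relative
   order of the rows of any two nonzero entries, and with it the permutation, is
   determined by the number of entries in each cell (i, j) and by the columns
   where runs start.  In each cell these data are a composition of the degree
   d_ij together with a nonzero scalar for each part, that is, a monic polynomial
   of degree d_ij with nonzero constant term: its exponents are the columns where
   runs start and its coefficients are the entries there. *)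

Require Import Defs.
From HB Require Import structures.
From mathcomp Require Import all_boot all_order all_algebra.
From mathcomp Require Import classical_sets functions.
From mathcomp Require Import zify.

Set Implicit Arguments.
Unset Strict Implicit.
Unset Printing Implicit Defensive.

Import GRing.Theory.
Local Open Scope ring_scope.

(** * The matrices attached to a polynomial *)

Lemma conform_mx_castE (T : Type) (m m' n n' : nat) (em : m = m') (en : n = n')
    (B : 'M[T]_(m', n')) (A : 'M[T]_(m, n)) i j :
  conform_mx B A i j = A (cast_ord (esym em) i) (cast_ord (esym en) j).
Proof.
case: m' / em B i; case: n' / en j => B i j.
by rewrite conform_mx_id !cast_ord_id.
Qed.

Lemma part_start_lt (l : nat) (mu : 'I_l -> nat) (i j : 'I_l) :
  (i < j)%N -> (part_start mu i + mu i <= part_start mu j)%N.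
Proof.
move=> ij; rewrite /part_start [leqRHS](bigID (fun x : 'I_l => (x < i)%N)) /=.
apply: leq_add; last by rewrite (bigD1 i) ?ij ?ltnn ?leq_addr.
rewrite [leqRHS](eq_bigl (fun x : 'I_l => (x < i)%N)) // => x.
by case: (ltnP x i) => xi; rewrite ?andbF // (ltn_trans xi ij).
Qed.

(** Block [k] occupies the indices from S to S + g - 1, and its antidiagonal is s + t = S + (S + g -
    1). This equation forces [s] into the same block, so it also accounts for the zeros off the
    diagonal blocks. *)
Lemma mxdiag_antidiagE (F : finFieldType) (r : nat) (g : 'I_r -> nat)
    (c : 'I_r -> F) (k : 'I_r) (s t : 'I_(\sum_i g i)) :
  (part_start g k <= t < part_start g k + g k)%N ->
  (\mxdiag_i (c i *: antidiag F (g i))) s t =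
    c k *+ (s + t == part_start g k + (part_start g k + g k).-1 :> nat)%N.
Proof.
move=> tk; have kE : tagnat.sig1 t = k.
  apply/val_inj; move: tk; rewrite {1 2}(tagnat.rect t) -/(part_start g _).
  move: (tagnat.sig1 t) (tagnat.sig2 t) => i w; have := ltn_ord w.
  by case: (ltngtP i k) => // /(part_start_lt g); lia.
have sE := tagnat.rect s; have tE := tagnat.rect t.
rewrite -/(part_start g _) in sE tE.
rewrite !mxE; move: (tagnat.sig1 s) (tagnat.sig2 s) sE => i u sE.
move: (tagnat.sig1 t) (tagnat.sig2 t) kE tE => j w kE.
rewrite {j}kE in w * => tE; case: eqVneq => [ik|ik]; last first.
  rewrite mxE; case: eqP => // E.
  have := ltn_ord u; have := ltn_ord w.
  move: ik; rewrite -val_eqE /= neq_ltn => /orP[] /(part_start_lt g); lia.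
rewrite {i}ik in u sE *; rewrite conform_mx_id !mxE mulr_natr.
congr (_ *+ nat_of_bool _); rewrite -val_eqE /=.
rewrite -/(part_start g k) in tE; have ug := ltn_ord u; have wg := ltn_ord w.
by rewrite sE tE; apply/eqP/eqP; lia.
Qed.

Section PolynomialRuns.

Variable F : finFieldType.
Implicit Types (f : {poly F}) (p q : nat).

(** Two consecutive exponents of [f]: they delimit the columns of one antidiagonal summand of
    [v_poly f]. *)
Definition run f p q : Prop :=
  [/\ (p < q)%N, f`_p != 0, f`_q != 0 & forall i, (p < i < q)%N -> f`_i = 0].

Lemma monic_coef_pdeg f : f \is monic -> f`_(pdeg f) = 1.
Proof. by move/monicP. Qed.

Lemma coef_gt_pdeg f i : (pdeg f < i)%N -> f`_i = 0.
Proof. by rewrite /pdeg => fi; apply: nth_default; move: fi; case: (size f). Qed.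

Lemma run_le_pdeg f p q : run f p q -> (q <= pdeg f)%N.
Proof.
by move=> [_ _ fq _]; rewrite leqNgt; apply: contraNN fq => /coef_gt_pdeg ->.
Qed.

(** The exponents 0 and [pdeg f] surround [k]; take the greatest exponent up to [k] and the least
    one above it. *)
Lemma runP f k : f \is monic -> f.[0] != 0 -> (k < pdeg f)%N ->
  exists p q, run f p q /\ (p <= k < q)%N.
Proof.
move=> fm; rewrite horner_coef0 => f0 kd.
have exq : exists i, (k < i)%N && (f`_i != 0).
  by exists (pdeg f); rewrite kd monic_coef_pdeg // oner_neq0.
have exp : exists i, (i <= k)%N && (f`_i != 0) by exists 0%N.
have bp i : (i <= k)%N && (f`_i != 0) -> (i <= k)%N by case/andP.
case: (ex_minnP exq) => q /andP[kq fq] minq.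
case: (ex_maxnP exp bp) => p /andP[pk fp] maxp.
exists p, q; split; last by rewrite pk.
split=> // [|i /andP[pi iq]]; first exact: leq_ltn_trans kq.
apply/eqP/negPn/negP => fi; case: (leqP i k) => ik.
  by have := maxp i; rewrite ik fi => /(_ isT); rewrite leqNgt pi.
by have := minq i; rewrite ik fi => /(_ isT); rewrite leqNgt iq.
Qed.

Lemma run_uniq f p q p' q' k : run f p q -> run f p' q' ->
  (p <= k < q)%N -> (p' <= k < q')%N -> p = p' /\ q = q'.
Proof.
have H : forall p q p' q', run f p q -> run f p' q' ->
    (p <= k < q)%N -> (p' <= k < q')%N -> (p <= p')%N /\ (q' <= q)%N.
  move=> {}p {}q {}p' {}q' [_ fp fq f0] [_ fp' fq' f0'] kpq kpq'.
  split; rewrite leqNgt; apply/negP => lt.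
    by move: fp; rewrite f0' ?eqxx //; lia.
  by move: fq; rewrite f0' ?eqxx //; lia.
move=> r r' kr kr'.
by have := H _ _ _ _ r r' kr kr'; have := H _ _ _ _ r' r kr' kr; lia.
Qed.

Lemma run_lt f p q p' q' k k' : run f p q -> run f p' q' ->
  (p <= k < q)%N -> (p' <= k' < q')%N -> (k <= k')%N ->
  (q <= p')%N \/ (p = p' /\ q = q').
Proof.
move=> r r' kr kr' kk'; case: (leqP q p') => qp'; first by left.
right; apply: (run_uniq r r' (k := k)) => //.
case: (r) => _ fp fq f0; case: (r') => _ fp' fq' f0'.
apply/andP; split; last by lia.
by rewrite leqNgt; apply/negP => lt; move: fp'; rewrite f0 ?eqxx //; lia.
Qed.

Lemma run_exponents f (k : 'I_(size (exponents f)).-1) :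
  run f (nth 0%N (exponents f) k) (nth 0%N (exponents f) k.+1).
Proof.
set e := exponents f.
have e_sorted : sorted ltn e.
  by apply: (sorted_filter ltn_trans); exact: iota_ltn_sorted.
have mem_e i : (i \in e) = (f`_i != 0).
  rewrite mem_filter mem_iota add0n /=; case: (ltnP i (size f)) => fi.
    by rewrite andbT.
  by rewrite andbF nth_default ?eqxx.
have ke : (k.+1 < size e)%N by rewrite -ltn_predRL.
split.
- by apply: (sorted_ltn_nth ltn_trans) => //; rewrite inE // ltnW.
- by rewrite -mem_e mem_nth // ltnW.
- by rewrite -mem_e mem_nth.
have e_mono := sorted_leq_nth leq_trans leqnn 0%N (sub_sorted ltnW e_sorted).
move=> i /andP[ki ik]; apply/eqP/negPn; rewrite -mem_e; apply/negP => ie.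
move: ki ik; rewrite -(nth_index 0%N ie).
have im : (index i e < size e)%N by rewrite index_mem.
case: (leqP (index i e) k) => ile.
  by rewrite ltnNge (e_mono _ _ _ _ ile) ?inE // ltnW.
by move=> _; rewrite ltnNge (e_mono _ _ _ _ ile) ?inE.
Qed.

Lemma part_start_gap f (k : 'I_(size (exponents f)).-1) : f.[0] != 0 ->
  part_start (gap (f := f)) k = nth 0%N (exponents f) k.
Proof.
rewrite horner_coef0 => f0; set e := exponents f.
have e0 : nth 0%N e 0 = 0%N.
  rewrite /e /exponents; have : (0 < size f)%N.
    by rewrite lt0n size_poly_eq0; apply: contraNneq f0 => ->; rewrite coef0.
  by case: (size f) => //= m _; rewrite f0.
rewrite /part_start -(big_ord_widen _ (fun i => nth 0 e i.+1 - nth 0 e i)%N);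
  last first.
  by rewrite ltnW.
rewrite -(big_mkord xpredT (fun k => nth 0 e k.+1 - nth 0 e k)%N).
rewrite telescope_sumn_in // ?e0 ?subn0 // => i /andP[_ ik].
have ir : (i < (size e).-1)%N by rewrite (ltn_trans ik).
by have [/ltnW] := run_exponents (Ordinal ir).
Qed.

(** The left factor reverses the rows, so with m the degree the antidiagonal (m - 1 - s) + t = p + q
    - 1 of a summand becomes a diagonal: along a run the row goes down by one with each column. The
    equation is written without subtraction. *)
Lemma v_polyE f p q (s t : 'I_(pdeg f)) : f.[0] != 0 ->
  run f p q -> (p <= t < q)%N ->
  v_poly f s t = f`_p *+ (s + p + q == pdeg f + t)%N.
Proof.
move=> f0 rpq tpq; have szg := sum_gap f0.
rewrite /v_poly mxE (bigD1 (rev_ord s)) //= [X in _ + X]big1 => [|u /negPf us];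
  last first.
  by rewrite mxE us mul0r.
rewrite mxE eqxx mul1r addr0 (conform_mx_castE szg szg).
set t' := cast_ord _ t; have := tagnat.rect t'.
set k := tagnat.sig1 t'; rewrite -/(part_start _ k) part_start_gap //= => tE.
have gk : gap k = (nth 0 (exponents f) k.+1 - nth 0 (exponents f) k)%N by [].
have rk := run_exponents k; have [kk _ _ _] := rk.
have tk : (nth 0 (exponents f) k <= t < nth 0 (exponents f) k.+1)%N.
  by have := ltn_ord (tagnat.sig2 t'); rewrite -/k; lia.
have [pE qE] := run_uniq rpq rk tpq tk.
rewrite /v_diag (mxdiag_antidiagE _ (k := k)) /=; last first.
  by rewrite part_start_gap //= gk; lia.
rewrite part_start_gap // gk -pE -qE; congr (_ *+ nat_of_bool _).
by have sd := ltn_ord s; apply/eqP/eqP; lia.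
Qed.

End PolynomialRuns.

(** * Blocks of a composition *)

Section Blocks.

Variables (n l : nat) (mu : 'I_l -> nat).
Hypothesis mu_n : (\sum_i mu i)%N = n.

Definition part_of (x : 'I_n) : 'I_l := tagnat.sig1 (cast_ord (esym mu_n) x).

Lemma part_of_bounds x :
  (part_start mu (part_of x) <= x < part_start mu (part_of x) + mu (part_of x))%N.
Proof.
rewrite /part_of; set y := cast_ord _ x; have := tagnat.rect y.
rewrite -/(part_start mu _) /= => ->.
by rewrite leq_addr ltn_add2l ltn_ord.
Qed.

Lemma part_of_eq x i :
  (part_of x == i) = (part_start mu i <= x < part_start mu i + mu i)%N.
Proof.
have := part_of_bounds x; case: eqVneq => [-> -> //|xi] xb.
by move: xi; rewrite -val_eqE /= neq_ltn => /orP[] /(part_start_lt mu); lia.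
Qed.

Lemma part_of_mono (x y : 'I_n) : (x <= y)%N -> (part_of x <= part_of y)%N.
Proof.
move=> xy; rewrite leqNgt; apply/negP => /(part_start_lt mu).
by have := part_of_bounds x; have := part_of_bounds y; lia.
Qed.

Lemma part_end_le i : (part_start mu i + mu i <= n)%N.
Proof.
rewrite -mu_n (bigID (fun k : 'I_l => (k < i)%N)) /= leq_add2l.
by rewrite (bigD1 i) ?ltnn ?leq_addr.
Qed.

Definition adjacent (x y : 'I_n) : bool :=
  (y == x.+1 :> nat) && (part_of x == part_of y).

(** Indices count from 0, so [x.+1] is a partial sum exactly when [x] is the last index of its part.
    Adjacent pairs are thus those on which [psi_mu] is given by [psi]. *)
Lemma adjacentE (x y : 'I_n) :
  adjacent x y = (y == x.+1 :> nat) && (x.+1 \notin partial_sums mu).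
Proof.
rewrite /adjacent; case: eqP => //= yx.
have sumE (k : 'I_l) : (\sum_(j < l | (j <= k)%N) mu j)%N =
    (part_start mu k + mu k)%N.
  rewrite /part_start addnC [LHS](bigD1 k) //=; congr addn.
  by apply: eq_bigl => i; rewrite ltn_neqAle -val_eqE /= andbC.
have bx := part_of_bounds x; have byy := part_of_bounds y.
case: eqVneq => [xy|xy]; apply/esym.
  rewrite -xy in byy; apply/negP => /mapP[k _]; rewrite sumE.
  have := part_start_lt mu (i := k) (j := part_of x).
  have := part_start_lt mu (i := part_of x) (j := k).
  case: (ltngtP k (part_of x)) => [||/val_inj ->]; lia.
apply/negbTE/negPn; apply/mapP; exists (part_of x); rewrite ?mem_enum // sumE.
have xy' : (part_of x < part_of y)%N.
  by rewrite ltn_neqAle -val_eqE /= in xy *; rewrite xy part_of_mono // yx.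
by have := part_start_lt mu xy'; lia.
Qed.

End Blocks.

(** * Reverse stacking of cells: sums over the indices after a given one *)

Section TailSums.

Variables (l : nat) (d : 'I_l -> nat).

Lemma tail_sum_lt (i i' : 'I_l) : (i < i')%N ->
  (\sum_(k < l | (i' < k)%N) d k + d i' <= \sum_(k < l | (i < k)%N) d k)%N.
Proof.
move=> ii'; rewrite [leqRHS](bigD1 i') //= addnC leq_add2l.
rewrite [leqRHS](bigID (fun k : 'I_l => (i' < k)%N)) /=.
rewrite [X in (_ <= X + _)%N](eq_bigl (fun k : 'I_l =>
  (i' < k)%N)) ?leq_addr // => k.
by rewrite -val_eqE /=; lia.
Qed.

Lemma tail_sum_le (i : 'I_l) :
  (\sum_(k < l | (i < k)%N) d k + d i <= \sum_k d k)%N.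
Proof.
rewrite [leqRHS](bigD1 i) //= addnC leq_add2l.
rewrite [leqRHS](bigID (fun k : 'I_l => (i < k)%N)) /=.
rewrite [X in (_ <= X + _)%N](eq_bigl (fun k : 'I_l =>
  (i < k)%N)) ?leq_addr // => k.
by rewrite -val_eqE /=; lia.
Qed.

(** The sums over k >= m decrease from the total to 0 as m grows. The least m whose sum is at most
    [x] is positive, and [i] is its predecessor. *)
Lemma tail_sum_exists x : (x < \sum_i d i)%N ->
  exists i : 'I_l,
    (\sum_(k < l | (i < k)%N) d k <= x < \sum_(k < l | (i < k)%N) d k + d i)%N.
Proof.
move=> xd; pose T m := (\sum_(k < l | (m <= k)%N) d k)%N.
have exT : exists m, (T m <= x)%N.
  exists l; rewrite /T big_pred0 // => k; by rewrite leqNgt ltn_ord.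
case: (ex_minnP exT) => -[|m] Tm minm.
  by move: Tm; rewrite /T leqNgt xd.
have ml : (m < l)%N.
  rewrite ltnNge; apply/negP => lm; suff /minm : (T m <= x)%N by rewrite ltnn.
  rewrite /T big_pred0 // => k.
  by apply/negbTE; rewrite -ltnNge (leq_trans (ltn_ord k)).
exists (Ordinal ml) => /=; rewrite -/(T m.+1) Tm /=.
have : (x < T m)%N by rewrite ltnNge; apply/negP => /minm; rewrite ltnn.
rewrite /T (bigD1 (Ordinal ml)) //= addnC => /leq_trans; apply.
rewrite leq_add2r; apply: eq_leq; apply: eq_bigl => k.
by rewrite -val_eqE /=; lia.
Qed.

End TailSums.

(** * Monomial matrices and the characters of the unitriangular group *)

Section MonomialMatrices.

Variables (F : finFieldType) (n : nat).
Implicit Types (u v : 'M[F]_n) (rho : 'I_n -> 'I_n) (c : 'I_n -> F).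

(* [rho] sends a column to the row of its nonzero entry, so it is the inverse of
   the row-to-column permutation. *)
Definition mono_mx rho c : 'M[F]_n := \matrix_(x, t) (c t *+ (x == rho t)).

Lemma mono_mxP v : monomial_mx v ->
  exists rho c, [/\ injective rho, forall t, c t != 0 & v = mono_mx rho c].
Proof.
move=> [vrow vcol].
have /fin_all_exists[rho rhoP] : forall t, exists x, unique (fun x =>
  v x t != 0) x.
  by move=> t; have [x] := vcol t; exists x.
exists rho, (fun t => v (rho t) t); split.
- move=> s t st; have [j [_ uj]] := vrow (rho s).
  rewrite -(uj s); last by case: (rhoP s).
  by apply: uj; rewrite st; case: (rhoP t).
- by move=> t; case: (rhoP t).
- apply/matrixP => x t; rewrite mxE; case: eqVneq => [->|xt] //.
  apply/eqP/negPn/negP => vx; case/negP: xt; rewrite eq_sym.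
  by apply/eqP; case: (rhoP t) => _; apply.
Qed.

Variables (rho : 'I_n -> 'I_n) (c : 'I_n -> F).
Hypotheses (rho_inj : injective rho) (c_neq0 : forall t, c t != 0).

Local Notation v := (mono_mx rho c).

Lemma monomial_mono_mx : monomial_mx v.
Proof.
have vE x t : (v x t != 0) = (x == rho t).
  by rewrite mxE; case: (x =P rho t) => _; rewrite ?c_neq0 ?mulr0n ?eqxx.
split=> [x|t].
  exists (invF rho_inj x); split=> [|t]; rewrite vE ?f_invF //.
  by move/eqP ->; rewrite invF_f.
by exists (rho t); split=> [|x]; rewrite vE ?eqxx // => /eqP ->.
Qed.

Lemma mono_mx_unit : v \in unitmx.
Proof.
suff /mulmx1_unit[] : (\matrix_(t, x) ((c t)^-1 *+ (x == rho t))) *m v =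
  1%:M by [].
apply/matrixP => s t; rewrite !mxE (bigD1 (rho s)) //= big1 => [|x /negPf xs].
  rewrite !mxE eqxx addr0 (inj_eq rho_inj); case: eqVneq => [->|_].
    by rewrite mulVf.
  by rewrite mulr0.
by rewrite !mxE xs mul0r.
Qed.

Lemma mono_mx_mul u x t : (v *m u) (rho x) t = c x * u x t.
Proof.
rewrite mxE (bigD1 x) //= mxE eqxx big1 ?addr0 // => s /negPf sx.
by rewrite mxE (inj_eq rho_inj) eq_sym sx mul0r.
Qed.

Lemma mul_mono_mx u x t : (u *m v) x t = u x (rho t) * c t.
Proof.
rewrite mxE (bigD1 (rho t)) //= mxE eqxx big1 ?addr0 // => s /negPf sx.
by rewrite mxE sx mulr0.
Qed.

Lemma mono_mx_xij s t (a : F) :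
  v *m xij s t a *m invmx v = xij (rho s) (rho t) (a * c s / c t).
Proof.
suff -> : v *m xij s t a = xij (rho s) (rho t) (a * c s / c t) *m v.
  by rewrite mulmxK // mono_mx_unit.
apply/matrixP => x y; rewrite mulmx_xij mul_mono_mx !mxE mulrDl (inj_eq rho_inj).
have -> : (x == rho y)%:R * c y = c y *+ (x == rho y) by rewrite mulr_natl.
congr (_ + _); case: (eqVneq y t) => [->|_]; last by rewrite andbF mulr0 mul0r.
by rewrite andbT mulrAC mulfVK // mulr_natr mulrnAr.
Qed.

End MonomialMatrices.

(** Induction on the number of nonzero entries above the diagonal. The condition [u i j != 0]
    ensures that, when a monomial matrix conjugates [u] into a unitriangular matrix, it does the
    same to the factor split off. *)
Lemma unitriangular_ind (F : finFieldType) (n : nat) (P : 'M[F]_n -> Prop) :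
  P 1%:M ->
  (forall u (i j : 'I_n), unitriangular u -> (i < j)%N -> u i j != 0 ->
     P (u *m xij i j (- u i j)) -> P u) ->
  forall u, unitriangular u -> P u.
Proof.
move=> P1 Pstep u.
pose A (u : 'M[F]_n) :=
  [set p : 'I_n * 'I_n | (p.1 < p.2)%N && (u p.1 p.2 != 0)].
have [m] := ubnP #|A u|; elim: m u => // m IHm u Am Uu.
case: (set_0Vmem (A u)) => [A0|[p0 p0A]].
  suff -> : u = 1%:M by [].
  apply/matrixP => i j; rewrite mxE; case: (leqP j i) => [/Uu //|ij].
  rewrite -val_eqE /= ltn_eqF //; apply/eqP/negPn/negP => uij.
  by move/setP/(_ (i, j)): A0; rewrite !inE ij uij.
(* In the topmost row in which u is not the identity, the column operation
   below changes no other entry. *)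
case: (@arg_minnP _ p0 [in A u] (fun p => p.1 : nat) p0A) => -[i j] /=.
rewrite inE /= => /andP[ij uij] min_i.
have ucol k : u k i = (k == i)%:R.
  case: (leqP i k) => [/Uu //|ki]; rewrite -val_eqE /= ltn_eqF //.
  apply/eqP/negPn/negP => uki; have := min_i (k, i).
  by rewrite inE /= ki uki leqNgt ki => /(_ isT).
have wE k p : (u *m xij i j (- u i j)) k p =
    if (k == i) && (p == j) then 0 else u k p.
  rewrite mulmx_xij ucol; case: (eqVneq k i) => [->|_]; last first.
    by rewrite mulr0 mul0rn addr0.
  by case: (eqVneq p j) => [->|_];
    rewrite /= ?mulr1 ?mulr1n ?addrN ?mulr0n ?addr0.
apply: (Pstep _ _ _ Uu ij uij); apply: IHm; last first.
  exact: (unitriangularM Uu (unitriangular_xij _ ij)).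
rewrite ltnS in Am; apply: (leq_trans _ Am); apply: proper_card.
apply/properP; split.
  apply/fintype.subsetP => -[k p]; rewrite !inE wE /=; case: ifP => //.
  by rewrite eqxx andbF.
by exists (i, j); rewrite !inE ?wE /= ?ij ?uij ?eqxx.
Qed.

Section Compatible.

Variables (F : finFieldType) (n l : nat) (mu : 'I_l -> nat).
Hypothesis mu_n : (\sum_i mu i)%N = n.

Local Notation part_of := (part_of mu_n).
Local Notation adjacent := (adjacent mu_n).

Definition compatible (rho : 'I_n -> 'I_n) (c : 'I_n -> F) : Prop :=
  forall s t : 'I_n, (s < t)%N -> (rho s < rho t)%N ->
    adjacent s t || adjacent (rho s) (rho t) ->
    [/\ adjacent s t, adjacent (rho s) (rho t) & c s = c t].

Section Characters.

Variables (C : numClosedFieldType) (psi : F -> C) (psi_mu : 'M[F]_n -> C).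
Hypotheses (psi_char : additive_character psi).
Hypotheses (psi_nt : nontrivial_character psi).
Hypothesis psi_muP : is_psi_mu psi mu psi_mu.
Variables (rho : 'I_n -> 'I_n) (c : 'I_n -> F).
Hypotheses (rho_inj : injective rho) (c_neq0 : forall t, c t != 0).

Local Notation v := (mono_mx rho c).

Lemma psi_mu_xij (i j : 'I_n) (t : F) : (i < j)%N ->
  psi_mu (xij i j t) = if adjacent i j then psi t else 1.
Proof. by move=> ij; rewrite (proj2 psi_muP) // -adjacentE. Qed.

(** Only the matrices [xij s t a] are tested, but for every [a]. If just one of the two pairs were
    adjacent, [psi] would be trivial; if both are, [psi] is invariant under multiplication by
    [c s / c t], which must then be 1. *)
Lemma N_mu_compatible : N_mu psi_mu v -> compatible rho c.
Proof.
move=> [_ _ vN] s t st rst; have [psi_neq0 psiD] := psi_char.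
have [x psix] := psi_nt.
have E a : (if adjacent s t then psi a else 1) =
    if adjacent (rho s) (rho t) then psi (a * c s / c t) else 1.
  rewrite -!psi_mu_xij // -mono_mx_xij //; apply: vN;
    first exact: unitriangular_xij.
  by rewrite mono_mx_xij //; apply: unitriangular_xij.
case: (adjacent s t) E => E; case: (adjacent (rho s) (rho t)) E => //= E _;
  last 2 first.
- by move: psix; rewrite E eqxx.
- have := E (x * c t / c s); rewrite mulfVK // mulfK // => /esym/eqP.
  by rewrite (negPf psix).
split=> //; apply/eqP/negPn/negP => cst.
pose r := c s / c t - 1.
have r0 : r != 0.
  rewrite subr_eq0; apply: contra cst => /eqP cE.
  by rewrite -[c s](mulfVK (c_neq0 t)) cE mul1r.
(* With a = x / r, multiplication by [c s / c t = r + 1] adds exactly [x], so the invariance of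
   [psi] gives [psi x = 1]. *)
have := E (x / r); rewrite -mulrA.
have -> : x / r * (c s / c t) = x / r + x.
  by rewrite -[c s / c t](subrK 1) -/r mulrDr mulr1 mulfVK // addrC.
rewrite psiD => /esym/eqP; rewrite -[X in _ == X]mulr1 =>
  /eqP/(mulfI (psi_neq0 _)).
by move/eqP; rewrite (negPf psix).
Qed.

Lemma compatible_N_mu : compatible rho c -> N_mu psi_mu v.
Proof.
move=> comp; split; [exact: mono_mx_unit|exact: monomial_mono_mx|].
have [[psi_neq0 psiM] _] := psi_muP.
have vU := mono_mx_unit rho_inj c_neq0.
apply: unitriangular_ind => [|u i j Uu ij uij IH Uw];
  first by rewrite mulmx1 mulmxV.
set w := v *m u *m invmx v in Uw *.
have wv : w *m v = v *m u by rewrite mulmxKV.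
(* Up to nonzero factors, [u i j] is the entry of [w] at [(rho i, rho j)]; as it is nonzero, that
   position lies above the diagonal. *)
have rij : (rho i < rho j)%N.
  rewrite ltnNge; apply/negP => /Uw wij.
  have := mono_mx_mul c rho_inj u i j;
    rewrite -wv mul_mono_mx wij (inj_eq rho_inj).
  rewrite -val_eqE /= ltn_eqF // mul0r => /esym/eqP.
  by rewrite mulf_eq0 (negPf (c_neq0 i)) (negPf uij).
pose x := xij i j (- u i j); pose y := xij (rho i) (rho j) (- u i j * c i / c j).
have Ux : unitriangular x by exact: unitriangular_xij.
have Uy : unitriangular y by exact: unitriangular_xij.
have uxE : v *m (u *m x) *m invmx v = w *m y.
  by rewrite /y -mono_mx_xij // !mulmxA mulmxKV.
have := IH; rewrite -/x uxE => /(_ (unitriangularM Uw Uy)).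
rewrite (psiM _ _ Uu Ux) (psiM _ _ Uw Uy).
suff -> : psi_mu x = psi_mu y by move/(mulIf (psi_neq0 _ Uy)).
rewrite !psi_mu_xij //; have := comp i j ij rij.
case: (adjacent i j); case: (adjacent (rho i) (rho j)) =>
  //= /(_ isT)[] // _ _ ->.
by rewrite mulfK.
Qed.

End Characters.

(** * The order pattern of a compatible permutation *)

Section Order.

Variables (rho : 'I_n -> 'I_n) (c : 'I_n -> F).
Hypotheses (rho_inj : injective rho) (rhoP : compatible rho c).

(* Column [t] continues, one row lower and with the same coefficient, the run of
   column [t - 1]. *)
Definition step (t : 'I_n) : bool :=
  [exists s, adjacent s t && adjacent (rho s) (rho t)].

Lemma stepP (s t : 'I_n) : t = s.+1 :> nat ->
  step t = adjacent s t && adjacent (rho s) (rho t).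
Proof.
move=> ts; apply/existsP/idP => [[s' /andP[a b]]|ab]; last by exists s.
have /andP[/eqP ts' _] := a.
have -> : s = s' by apply/val_inj; move: ts'; rewrite ts => -[].
by rewrite a.
Qed.

(** Between adjacent columns, compatibility turns any move to a lower row into a move to the
    adjacent row, that is, a step. *)
Lemma not_step_lt (s t : 'I_n) : adjacent s t -> ~~ step t -> (rho t < rho s)%N.
Proof.
move=> st; have /andP[/eqP ts _] := st; rewrite (stepP ts) st /=.
apply: contraNltn; rewrite leq_eqVlt => /orP[/eqP/val_inj/rho_inj ts'|rst].
  by move: ts; rewrite ts' => /eqP; rewrite ltn_eqF.
by have [|||_ -> _] := @rhoP s t; rewrite ?ts ?st -?ts.
Qed.

Lemma step_val (s t : 'I_n) : t = s.+1 :> nat -> step t ->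
  [/\ rho t = (rho s).+1 :> nat, part_of (rho s) = part_of (rho t) & c s = c t].
Proof.
move=> ts; rewrite (stepP ts) => /andP[st];
  rewrite {1}/adjacent => /andP[/eqP rts /eqP pst].
by have [|||_ _ ->] := @rhoP s t; rewrite ?st ?ts ?rts.
Qed.

Lemma between_part (s r t : 'I_n) : (s <= r <= t)%N -> part_of s = part_of t ->
  part_of s = part_of r.
Proof.
move=> /andP[/(part_of_mono mu_n) sr /(part_of_mono mu_n) rt] st.
by apply/val_inj/eqP; rewrite eqn_leq sr {1}st rt.
Qed.

Lemma adjacent_pred (s t : 'I_n) : (s < t)%N -> part_of s = part_of t ->
  exists r : 'I_n, [/\ t = r.+1 :> nat, part_of s = part_of r & adjacent r t].
Proof.
move=> st pst; have rn : (t.-1 < n)%N by have := ltn_ord t; lia.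
have tr : t = (Ordinal rn).+1 :> nat by rewrite /=; lia.
have sr : part_of s = part_of (Ordinal rn) by apply: between_part pst;
  rewrite /=; lia.
by exists (Ordinal rn); split=> //; apply/andP; split;
  [exact/eqP|rewrite -sr pst].
Qed.

(** A step keeps the block of rows and any other move between adjacent columns goes up. This is why
    the cells of a column block appear in decreasing order of their row block. *)
Lemma part_of_antimono (s t : 'I_n) : (s <= t)%N -> part_of s = part_of t ->
  (part_of (rho t) <= part_of (rho s))%N.
Proof.
have [m] := ubnP t; elim: m s t => // m IHm s t tm.
rewrite leq_eqVlt => /orP[/eqP/val_inj -> //|st] pst.
have [r [tr psr rt]] := adjacent_pred st pst.
apply: (leq_trans (n := part_of (rho r))); last by apply: IHm => //; lia.
have [/(step_val tr)[_ -> _] //|/(not_step_lt rt) rtr] := boolP (step t).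
by apply: part_of_mono; exact: ltnW.
Qed.

(** For columns of one part, this says that they lie in the same run; [s] itself is excluded since
    it may start the run. *)
Definition all_steps (s t : 'I_n) : bool :=
  [forall r : 'I_n, (s < r <= t)%N ==> step r].

Lemma all_steps_val (s t : 'I_n) : (s <= t)%N -> part_of s = part_of t ->
  all_steps s t -> (rho t + s = rho s + t)%N.
Proof.
have [m] := ubnP t; elim: m s t => // m IHm s t tm.
rewrite leq_eqVlt => /orP[/eqP/val_inj -> //|st] pst sst.
have [r [tr psr rt]] := adjacent_pred st pst.
have stept : step t by have /forallP/(_ t) := sst; rewrite st leqnn.
have ssr : all_steps s r.
  apply/forallP => x; apply/implyP => sxr.
  by have /forallP/(_ x)/implyP := sst; apply; lia.
have [rts _ _] := step_val tr stept.
have [rm sr] : (r < m)%N /\ (s <= r)%N by lia.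
by have := IHm s r rm sr psr ssr; lia.
Qed.

(** Every run lies above all earlier runs of its part. A new run starts above the entry just before
    it and cannot land among the rows already taken by the run of [s]; later steps go down one row
    at a time and cannot cross the occupied row [rho s]. *)
Lemma not_all_steps_lt (s t : 'I_n) : (s < t)%N -> part_of s = part_of t ->
  ~~ all_steps s t -> (rho t < rho s)%N.
Proof.
have [m] := ubnP t; elim: m s t => // m IHm s t tm st pst nsst.
have [r [tr psr rt]] := adjacent_pred st pst.
have nst : rho t != rho s by rewrite (inj_eq rho_inj) -val_eqE /= gtn_eqF.
have [stept|nstept] := boolP (step t).
  have [rts _ _] := step_val tr stept.
  have sr : (s < r)%N.
    have sr : (s <= r)%N by lia.
    rewrite ltn_neqAle sr andbT; apply: contraNN nsst => /eqP/val_inj {}sr.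
    apply/forallP => x; apply/implyP => sxt.
    by have -> : x = t by apply/val_inj => /=; rewrite sr in sxt; lia.
  have nssr : ~~ all_steps s r.
    apply: contraNN nsst => /forallP ssr; apply/forallP => x; apply/implyP => sxt.
    have [xr|rx] := leqP x r; first by have /implyP := ssr x; apply; lia.
    by have -> : x = t by apply/val_inj => /=; lia.
  have rm : (r < m)%N by lia.
  by have := IHm s r rm sr psr nssr; rewrite -val_eqE /= in nst; lia.
have rtr := not_step_lt rt nstept.
have sr : (s <= r)%N by lia.
have [ssr|nssr] := boolP (all_steps s r); last first.
  have {}sr : (s < r)%N.
    rewrite ltn_neqAle sr andbT; apply: contraNN nssr => /eqP/val_inj ->.
    by apply/forallP => x; apply/implyP; lia.
  have rm : (r < m)%N by lia.
  by have := IHm s r rm sr psr nssr; lia.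
rewrite ltnNge; apply/negP => rst.
(* [rho] maps [s, r] onto [rho s, rho r], which would contain [rho t]. *)
have rsr := all_steps_val sr psr ssr.
have xn : (s + (rho t - rho s) < n)%N by have := ltn_ord r; lia.
pose x := Ordinal xn; have sxr : (s <= x <= r)%N by rewrite /=; lia.
have psx := between_part sxr psr.
have ssx : all_steps s x.
  apply/forallP => y; apply/implyP => sy.
  by have /forallP/(_ y)/implyP := ssr; apply; lia.
have /andP[sx _] := sxr; have := all_steps_val sx psx ssx => /= rx.
have : rho x = rho t by apply/val_inj => /=; lia.
by move/rho_inj/(congr1 val) => /=; lia.
Qed.

End Order.

End Compatible.

(** * Rigidity: row blocks and run starts determine a compatible matrix *)

Lemma eq_of_lt_mono (n : nat) (f g : 'I_n -> 'I_n) : injective f -> injective g ->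
  (forall s t, (f s < f t)%N -> (g s < g t)%N) -> f =1 g.
Proof.
have le (f' g' : 'I_n -> 'I_n) : injective f' -> injective g' ->
    (forall s t, (f' s < f' t)%N -> (g' s < g' t)%N) ->
      forall s, (f' s <= g' s)%N.
  move=> f_inj g_inj fg s.
  (* A permutation is recovered from the order of its values: [h s] is the number of values below
     it. *)
  have cardE (h : 'I_n -> 'I_n) : injective h -> #|[set t | (h t < h s)%N]| = h s.
    move=> h_inj; rewrite -[RHS](card_ord (h s)).
    rewrite -(card_imset _ h_inj).
    have hs : (h s <= n)%N by rewrite ltnW.
    have w_inj : injective (widen_ord hs) by move=> i j /(congr1 val) /= /val_inj.
    rewrite -cardsT -(card_imset _ w_inj); apply: eq_card => x.
    apply/imsetP/imsetP => [[t]|[t _ ->]].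
      by rewrite inE => ht ->; exists (Ordinal ht) => //; apply/val_inj.
    exists (invF h_inj (widen_ord hs t)); rewrite ?inE f_invF //=.
  rewrite -(cardE f') // -(cardE g') //; apply: subset_leq_card.
  by apply/fintype.subsetP => t; rewrite !inE; apply: fg.
move=> f_inj g_inj fg s; apply/val_inj/eqP; rewrite eqn_leq !le // => x y gxy.
rewrite ltnNge leq_eqVlt; apply/negP => /orP[/eqP/val_inj/f_inj yx|/fg].
  by rewrite yx ltnn in gxy.
by rewrite ltnNge (ltnW gxy).
Qed.

Section Rigidity.

Variables (F : finFieldType) (n l : nat) (mu : 'I_l -> nat).
Hypothesis mu_n : (\sum_i mu i)%N = n.

Local Notation part_of := (part_of mu_n).
Local Notation step := (step mu_n).

(** Compatibility is symmetric in rows and columns, so facts about column blocks transfer to row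
    blocks. *)
Lemma compatible_inv (rho : 'I_n -> 'I_n) (c : 'I_n ->
  F) (rho_inj : injective rho) :
  compatible mu_n rho c -> compatible mu_n (invF rho_inj) (c \o invF rho_inj).
Proof.
move=> rhoP s t st rst adj.
by have [] := rhoP _ _ rst; rewrite ?f_invF // orbC.
Qed.

Lemma part_of_antimono_inv (rho : 'I_n -> 'I_n) (c : 'I_n -> F) (s t : 'I_n) :
  injective rho -> compatible mu_n rho c ->
  (rho s <= rho t)%N -> part_of (rho s) = part_of (rho t) ->
    (part_of t <= part_of s)%N.
Proof.
move=> rho_inj rhoP rst pst.
have inv_inj : injective (invF rho_inj) by exact: can_inj (f_invF rho_inj).
have := part_of_antimono inv_inj (compatible_inv (rho_inj :=
  rho_inj) rhoP) rst pst.
by rewrite !invF_f.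
Qed.

(** If the two permutations ordered [s] and [t] differently, equality of row blocks would put both
    entries in one block of rows, and antitonicity for the two inverses would put both columns in
    one block. There the order depends only on whether the columns lie in one run. *)
Lemma compatible_lt (rho rho' : 'I_n -> 'I_n) (c c' : 'I_n -> F) (s t : 'I_n) :
  injective rho -> injective rho' ->
  compatible mu_n rho c -> compatible mu_n rho' c' ->
  (forall t, part_of (rho t) = part_of (rho' t)) ->
  (forall t, step rho t = step rho' t) ->
  (rho s < rho t)%N -> (rho' s < rho' t)%N.
Proof.
move=> rho_inj rho_inj' rhoP rhoP' prho steprho rst; rewrite ltnNge;
  apply/negP => rst'.
have all_stepsE x y : all_steps mu_n rho x y = all_steps mu_n rho' x y.
  by apply: eq_forallb => r; rewrite steprho.
have pst : part_of (rho s) = part_of (rho t).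
  apply/val_inj/eqP; rewrite eqn_leq {1}part_of_mono ?(ltnW rst) //=.
  by rewrite !prho part_of_mono.
have psteq : part_of s = part_of t.
  apply/val_inj/eqP; rewrite eqn_leq.
  rewrite (part_of_antimono_inv rho_inj' rhoP' rst') -?prho //.
  by rewrite (part_of_antimono_inv rho_inj rhoP (ltnW rst)).
have [st|ts|/val_inj st] := ltngtP s t; last by rewrite st ltnn in rst.
  have [sst|/(not_all_steps_lt rho_inj rhoP st psteq)] :=
    boolP (all_steps mu_n rho s t).
    have := all_steps_val rhoP (ltnW st) psteq sst.
    rewrite all_stepsE in sst.
    by have := all_steps_val rhoP' (ltnW st) psteq sst; lia.
  by rewrite ltnNge (ltnW rst).
have [sts|] := boolP (all_steps mu_n rho t s).
  by have := all_steps_val rhoP (ltnW ts) (esym psteq) sts; lia.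
rewrite all_stepsE => /(not_all_steps_lt rho_inj' rhoP' ts (esym psteq)).
by rewrite ltnNge rst'.
Qed.

Lemma compatible_eq (rho rho' : 'I_n -> 'I_n) (c c' : 'I_n -> F) :
  injective rho -> injective rho' ->
  compatible mu_n rho c -> compatible mu_n rho' c' ->
  (forall t, part_of (rho t) = part_of (rho' t)) ->
  (forall t, step rho t = step rho' t) ->
  (forall t, ~~ step rho t -> c t = c' t) ->
  rho =1 rho' /\ c =1 c'.
Proof.
move=> rho_inj rho_inj' rhoP rhoP' prho steprho cE; split.
  by apply: eq_of_lt_mono => // s t;
    apply: (compatible_lt rho_inj rho_inj' rhoP rhoP').
(* A step repeats the entry of the previous column, so the entries at run starts determine all of
   them. *)
move=> t; have [m] := ubnP t; elim: m t => // m IHm t tm.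
have [stept|/cE //] := boolP (step rho t).
have /existsP[s /andP[/andP[/eqP ts _] _]] := stept.
have [_ _ <-] := step_val rhoP ts stept.
rewrite steprho in stept; have [_ _ <-] := step_val rhoP' ts stept.
by apply: IHm; lia.
Qed.

End Rigidity.

(** * Encoding of monomial matrices by matrices of polynomials *)

Section Encoding.

Variables (F : finFieldType) (n l : nat) (mu : 'I_l -> nat).
Hypothesis mu_n : (\sum_i mu i)%N = n.
Implicit Types (rho : 'I_n -> 'I_n) (c : 'I_n -> F) (a : 'M[{poly F}]_l).

Local Notation part_of := (part_of mu_n).
Local Notation step := (step mu_n).

(* The first clause says that [a] has the right degrees: in every block of
   columns, the nonzero entries met in block of rows [i] are those of the columns
   of the cell [(i, j)].  The second one says that the lower coefficients of
   [a i j] are the entries at the columns where a run starts, and 0 elsewhere. *)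
Definition encodes a rho c : Prop :=
  (forall (t : 'I_n) (i : 'I_l),
     (i < part_of (rho t))%N = (t < col_start mu a i (part_of t))%N) /\
  (forall t : 'I_n,
     let i := part_of (rho t) in let j := part_of t in
     (a i j)`_(t - col_start mu a i j) = if step rho t then 0 else c t).

Lemma col_start_lt a (i i' j : 'I_l) : (i < i')%N ->
  (col_start mu a i' j + pdeg (a i' j) <= col_start mu a i j)%N.
Proof.
move=> ii'; rewrite /col_start -addnA leq_add2l.
exact: (tail_sum_lt (fun k => pdeg (a k j))).
Qed.

Lemma col_end_le a (i j : 'I_l) : M_mu F mu a ->
  (col_start mu a i j + pdeg (a i j) <= part_start mu j + mu j)%N.
Proof.
move=> [_ _ _ colsum]; rewrite /col_start -addnA leq_add2l -colsum.
exact: (tail_sum_le (fun k => pdeg (a k j))).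
Qed.

Lemma col_cell_exists a (t : 'I_n) : M_mu F mu a ->
  exists i, let j := part_of t in
    (col_start mu a i j <= t < col_start mu a i j + pdeg (a i j))%N.
Proof.
move=> [_ _ _ colsum] /=; have := part_of_bounds mu_n t; set j := part_of t => bt.
have := @tail_sum_exists l (fun k => pdeg (a k j)) (t - part_start mu j).
rewrite colsum => /(_ _)[|i bi]; first by lia.
by exists i; rewrite /col_start; lia.
Qed.

(** The cells tile each block of columns, so some cell contains [t]. The first clause of [encodes],
    applied to its row block and to that of [rho t], shows that the two agree. *)
Lemma encodes_cell a rho c (t : 'I_n) i : M_mu F mu a -> encodes a rho c ->
  let j := part_of t in
  (part_of (rho t) == i) =
  (col_start mu a i j <= t < col_start mu a i j + pdeg (a i j))%N.
Proof.
move=> aM [enc _] j.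
have imp k : (col_start mu a k j <= t < col_start mu a k j + pdeg (a k j))%N ->
    part_of (rho t) = k.
  rewrite /j => bt; have := enc t k; have := enc t (part_of (rho t)).
  case: (ltngtP k (part_of (rho t))) => [||/val_inj //]; first by lia.
  by move/(col_start_lt a (part_of t)); lia.
apply/eqP/idP => [<-|/imp //].
by have [i' bi] := col_cell_exists t aM; have := bi; rewrite (imp _ bi).
Qed.

(** Since the entries [c t] are nonzero, a zero coefficient marks exactly a step. The polynomials
    thus give the row blocks, the steps and the entries at run starts, and rigidity applies. *)
Lemma encodes_inj a rho rho' c c' : M_mu F mu a ->
  injective rho -> injective rho' ->
  (forall t, c t != 0) -> (forall t, c' t != 0) ->
  compatible mu_n rho c -> compatible mu_n rho' c' ->
  encodes a rho c -> encodes a rho' c' -> mono_mx rho c = mono_mx rho' c'.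
Proof.
move=> aM rho_inj rho_inj' c0 c0' rhoP rhoP' enc enc'.
have prho t : part_of (rho t) = part_of (rho' t).
  by apply/eqP; rewrite (encodes_cell _ _ aM enc) -(encodes_cell _ _ aM enc').
have gE t : (if step rho t then 0 else c t) = if step rho' t then 0 else c' t.
  by case: enc enc' => _ <- [_ <-]; rewrite prho.
have steprho t : step rho t = step rho' t.
  have := gE t; case: (step rho t); case: (step rho' t) => // /eqP.
    by rewrite eq_sym (negPf (c0' t)).
  by rewrite (negPf (c0 t)).
have [|rhoE cE] := compatible_eq rho_inj rho_inj' rhoP rhoP' prho steprho.
  by move=> t /negPf nt; have := gE t; rewrite -steprho nt.
by apply/matrixP => x t; rewrite !mxE rhoE cE.
Qed.

(** The row blocks of [rho] fix where each cell starts and ends, hence the degrees. The lower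
    coefficients are then read off column by column, and the leading one is 1. *)
Lemma encodes_uniq a a' rho c : M_mu F mu a -> M_mu F mu a' ->
  encodes a rho c -> encodes a' rho c -> a = a'.
Proof.
have colP b i j k : M_mu F mu b -> (k < pdeg (b i j))%N ->
    exists t : 'I_n, t = (col_start mu b i j + k)%N :> nat /\ part_of t = j.
  move=> bM kd; have := col_end_le i j bM; have := part_end_le mu_n j => n1 n2.
  have tn : (col_start mu b i j + k < n)%N by lia.
  exists (Ordinal tn); split=> //; apply/eqP; rewrite part_of_eq /=.
  by rewrite /col_start in n2 *; lia.
have start_le b b' i j : M_mu F mu b -> M_mu F mu b' ->
    encodes b rho c -> encodes b' rho c ->
      (col_start mu b i j <= col_start mu b' i j)%N.
  move=> bM bM' [enc _] [enc' _]; rewrite leqNgt; apply/negP => lt.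
  have := col_end_le i j bM; have := part_end_le mu_n j => n1 n2.
  have tn : (col_start mu b' i j < n)%N by lia.
  have pt : part_of (Ordinal tn) = j.
    by apply/eqP; rewrite part_of_eq /=; rewrite /col_start in n2 lt *; lia.
  by have := enc (Ordinal tn) i; rewrite enc' pt /= lt ltnn.
move=> aM aM' enc enc'.
have startE i j : col_start mu a i j = col_start mu a' i j.
  by apply/eqP; rewrite eqn_leq !start_le.
have deg_le b b' i j : M_mu F mu b -> M_mu F mu b' ->
    encodes b rho c -> encodes b' rho c ->
    col_start mu b i j = col_start mu b' i j -> (pdeg (b i j) <= pdeg (b' i j))%N.
  move=> bM bM' encb encb' bE; rewrite leqNgt; apply/negP => lt.
  have [t [tE pt]] := colP _ _ _ _ bM lt.
  have := encodes_cell t i bM encb; rewrite (encodes_cell t i bM' encb') pt.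
  by rewrite /= bE tE; lia.
have degE i j : pdeg (a i j) = pdeg (a' i j).
  by apply/eqP; rewrite eqn_leq !deg_le.
have [am _ _ _] := aM; have [am' _ _ _] := aM'.
apply/matrixP => i j; apply/polyP => k.
case: (ltngtP k (pdeg (a i j))) => [kd|dk|->].
- have [t [tE pt]] := colP _ _ _ _ aM kd.
  have /eqP pr : part_of (rho t) == i.
    by rewrite (encodes_cell _ _ aM enc) pt; lia.
  have [_ /(_ t) gE] := enc; have [_ /(_ t)] := enc'.
  by rewrite /= -gE pr pt -startE tE addKn.
- by rewrite !coef_gt_pdeg // -degE.
- by rewrite {2}degE !monic_coef_pdeg.
Qed.

End Encoding.

(** * Decoding: from a compatible matrix to polynomials, by counting entries in cells *)

Lemma sum_fiber (I : finType) (l : nat) (f : I ->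
  'I_l) (P : pred I) (Q : pred 'I_l) :
  (\sum_(k | Q k) \sum_(t | P t && (f t == k)) 1 = \sum_(t | P t && Q (f t)) 1)%N.
Proof.
rewrite [RHS](partition_big f Q) => [|t /andP[]//]; apply: eq_bigr => k Qk.
by apply: eq_bigl => t; case: eqP => [->|]; rewrite ?Qk ?andbT ?andbF.
Qed.

Lemma sum_interval (n b e : nat) : (e <= n)%N ->
  (\sum_(x < n | (b <= x < e)%N) 1 = e - b)%N.
Proof.
move=> en; have [be|eb] := leqP b e; last first.
  by rewrite big_pred0 => [|x]; lia.
rewrite -[RHS]muln1 -(sum_nat_const_nat b e 1) (big_nat_widenl b 0) //.
rewrite (big_nat_widen 0 e n) // big_mkord; apply: eq_bigl => x.
by rewrite /=; lia.
Qed.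

(** The solutions of [P] form an initial segment of the interval, whose end is therefore [b] plus
    their number. *)
Lemma antitone_count (n b e : nat) (P : pred 'I_n) (t : 'I_n) :
  (e <= n)%N -> (b <= t < e)%N ->
  (forall x y : 'I_n, (b <= x <= y)%N -> (y < e)%N -> P y -> P x) ->
  (t < b + \sum_(x < n | (b <= x < e)%N && P x) 1)%N = P t.
Proof.
move=> en bte anti; apply/idP/idP => [|Pt].
  apply: contraLR => nPt; rewrite -leqNgt.
  suff : (\sum_(x < n | (b <= x < e)%N && P x) 1 <= t - b)%N by lia.
  rewrite -(sum_interval b (n := n) (e := t)); last exact: ltnW.
  rewrite !sum1dep_card; apply: subset_leq_card; apply/fintype.subsetP => x.
  rewrite !inE => /andP[/andP[bx xe] Px]; rewrite bx ltnNge.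
  by apply: contraNN nPt => tx; apply: (anti _ x) => //; lia.
suff : (t.+1 - b <= \sum_(x < n | (b <= x < e)%N && P x) 1)%N by lia.
rewrite -(sum_interval b (n := n) (e := t.+1)) //.
rewrite !sum1dep_card; apply: subset_leq_card; apply/fintype.subsetP => x.
rewrite !inE => /andP[bx xt]; apply/andP; split; first by lia.
by apply: (anti _ t) => //; lia.
Qed.

Section Decoding.

Variables (F : finFieldType) (n l : nat) (mu : 'I_l -> nat).
Hypothesis mu_n : (\sum_i mu i)%N = n.
Variables (rho : 'I_n -> 'I_n) (c : 'I_n -> F).
Hypotheses (rho_inj : injective rho) (c_neq0 : forall t, c t != 0).
Hypothesis rhoP : compatible mu_n rho c.

Local Notation part_of := (part_of mu_n).
Local Notation step := (step mu_n).

Definition cell_size (i j : 'I_l) : nat :=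
  (\sum_(t : 'I_n | (part_of t == j) && (part_of (rho t) == i)) 1)%N.

Definition cell_start (i j : 'I_l) : nat :=
  (part_start mu j + \sum_(k < l | (i < k)%N) cell_size k j)%N.

(** Extended by 0 past the last column, so that it can be used under [\poly]. *)
Definition start_coef (x : nat) : F :=
  oapp (fun t => if step rho t then 0 else c t) 0 (insub x).

Definition decode : 'M[{poly F}]_l :=
  \matrix_(i, j) ('X^(cell_size i j) +
    \poly_(k < cell_size i j) start_coef (cell_start i j + k)).

Lemma start_coefE (t : 'I_n) : start_coef t = if step rho t then 0 else c t.
Proof. by rewrite /start_coef valK. Qed.

Lemma size_decode i j : size (decode i j) = (cell_size i j).+1.
Proof. by rewrite mxE size_polyDl size_polyXn // ltnS size_poly. Qed.

Lemma pdeg_decode i j : pdeg (decode i j) = cell_size i j.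
Proof. by rewrite /pdeg size_decode. Qed.

Lemma decode_monic i j : decode i j \is monic.
Proof.
by rewrite mxE monicE lead_coefDl ?lead_coefXn // size_polyXn ltnS size_poly.
Qed.

Lemma col_start_decode i j : col_start mu decode i j = cell_start i j.
Proof. by rewrite /col_start; under eq_bigr do rewrite pdeg_decode. Qed.

Lemma decode_coef i j k : (k < cell_size i j)%N ->
  (decode i j)`_k = start_coef (cell_start i j + k).
Proof. by move=> kd; rewrite mxE coefD coefXn coef_poly kd ltn_eqF // add0r. Qed.

Lemma sum_part (P : pred 'I_n) j :
  (\sum_(t | (part_of t == j) && P t) 1 =
   \sum_(t < n | (part_start mu j <= t < part_start mu j + mu j)%N && P t) 1)%N.
Proof. by apply: eq_bigl => t; rewrite part_of_eq. Qed.

(** For an upward closed [Q], antitonicity of the row block makes the columns with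
    [Q (part_of (rho t))] an initial segment of their part, and the cell sizes count them. Taking k
    > i and k >= i locates both ends of a cell. *)
Lemma ltn_block_count (t : 'I_n) (Q : pred 'I_l) :
  (forall k k' : 'I_l, (k <= k')%N -> Q k -> Q k') ->
  (t < part_start mu (part_of t) + \sum_(k | Q k) cell_size k (part_of t))%N =
  Q (part_of (rho t)).
Proof.
move=> Qup; rewrite (sum_fiber (part_of \o rho)) (sum_part (fun t =>
  Q (part_of (rho t)))).
rewrite antitone_count ?part_end_le ?part_of_bounds // => x y xy ye.
have px : part_of x = part_of t by apply/eqP; rewrite part_of_eq; lia.
have py : part_of y = part_of t by apply/eqP; rewrite part_of_eq; lia.
by apply: Qup; apply: (part_of_antimono rho_inj rhoP); [lia|rewrite px py].
Qed.

Lemma ltn_cell_start (t : 'I_n) i :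
  (t < cell_start i (part_of t))%N = (i < part_of (rho t))%N.
Proof. by rewrite ltn_block_count // => k k' kk' /leq_trans; apply. Qed.

Lemma ltn_cell_end (t : 'I_n) i :
  (t < cell_start i (part_of t) + cell_size i (part_of t))%N =
    (i <= part_of (rho t))%N.
Proof.
rewrite -(ltn_block_count t (Q := fun k : 'I_l => (i <= k)%N)) =>
  [|k k' kk' /leq_trans]; last exact.
rewrite [in RHS](bigD1 i) //= /cell_start -addnA.
rewrite [in LHS](addnC _ (cell_size i _)).
congr (_ < _ + (_ + _))%N; apply: eq_bigl => k.
by rewrite -val_eqE /=; lia.
Qed.

Lemma decode_encodes : encodes mu_n decode rho c.
Proof.
split=> t => [i|]; rewrite /= col_start_decode; first by rewrite ltn_cell_start.
have := ltn_cell_start t (part_of (rho t));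
  have := ltn_cell_end t (part_of (rho t)).
rewrite leqnn ltnn => tlt tge.
by rewrite decode_coef ?subnKC ?start_coefE //; lia.
Qed.

Lemma cell_end_le i j :
  (cell_start i j + cell_size i j <= part_start mu j + mu j)%N.
Proof.
rewrite /cell_start -addnA leq_add2l.
apply: leq_trans (tail_sum_le (fun k => cell_size k j) i) _.
rewrite (sum_fiber (part_of \o rho) _ predT) (sum_part predT).
by under eq_bigl do rewrite andbT; rewrite sum_interval ?part_end_le // addKn.
Qed.

Lemma decode_M_mu : M_mu F mu decode.
Proof.
have sumP j : (\sum_(t | part_of t == j) 1 = mu j)%N.
  by under eq_bigl do rewrite part_of_eq;
    rewrite sum_interval ?part_end_le // addKn.
split=> [i j|i j|i|j]; first exact: decode_monic.
(* An empty cell gives the polynomial 1. Otherwise the constant term belongs to the first column of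
   the cell, which is not a step: its predecessor would lie in the same cell, before its start. *)
- rewrite horner_coef0; case: (posnP (cell_size i j)) => [d0|d0].
    by rewrite mxE d0 coefD coefXn coef_poly addr0 oner_neq0.
  have bd := cell_end_le i j; have en := part_end_le mu_n j.
  have tn : (cell_start i j < n)%N by lia.
  pose t := Ordinal tn; have pt : part_of t = j.
    by apply/eqP; rewrite part_of_eq /=; rewrite /cell_start in bd *; lia.
  have pr : part_of (rho t) = i.
    have := ltn_cell_start t i; have := ltn_cell_end t i; rewrite pt /=.
    by move=> ? ?; apply/val_inj => /=; lia.
  rewrite decode_coef // addn0 -[cell_start i j]/(nat_of_ord t) start_coefE.
  case: ifP => [|_]; last exact: c_neq0.
  case/existsP => s /andP[/andP[/eqP ts /eqP pst] /andP[_ /eqP prst]].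
  have := ltn_cell_start s i; rewrite pst pt prst pr ltnn => /negbT.
  by rewrite -leqNgt -[cell_start i j]/(nat_of_ord t) ts ltnn.
- under eq_bigr do rewrite pdeg_decode.
  transitivity (\sum_(t | part_of (rho t) == i) 1)%N.
    rewrite /cell_size; under eq_bigr do under eq_bigl do rewrite andbC.
    rewrite (sum_fiber part_of (fun t => part_of (rho t) == i) predT).
    by apply: eq_bigl => t; rewrite andbT.
  by rewrite -[RHS]sumP [RHS](reindex_inj rho_inj).
- under eq_bigr do rewrite pdeg_decode.
  rewrite (sum_fiber (part_of \o rho) (fun t => part_of t == j) predT) -[RHS]sumP.
  by apply: eq_bigl => t; rewrite andbT.
Qed.

End Decoding.

(** * Encoding: the matrix built from polynomials is compatible and encoded by them *)

Section Encode.

Variables (F : finFieldType) (n l : nat) (mu : 'I_l -> nat).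
Hypothesis mu_n : (\sum_i mu i)%N = n.
Variable a : 'M[{poly F}]_l.
Hypothesis aM : M_mu F mu a.

Local Notation part_of := (part_of mu_n).
Local Notation adjacent := (adjacent mu_n).
Local Notation step := (step mu_n).

(* Column [k] of the block of [a i j], in the run of exponents [p <= k < q]; its
   nonzero entry lies in row [pdeg - q + (k - p)] of that block, written without
   subtraction. *)
Definition in_cell (i j : 'I_l) (p q k t x : nat) (e : F) : Prop :=
  [/\ run (a i j) p q, (p <= k < q)%N, t = (col_start mu a i j + k)%N,
      (x + p + q = row_start mu a i j + pdeg (a i j) + k)%N & e = (a i j)`_p].

Lemma row_start_lt (i j j' : 'I_l) : (j < j')%N ->
  (row_start mu a i j' + pdeg (a i j') <= row_start mu a i j)%N.
Proof.
move=> jj'; rewrite /row_start -addnA leq_add2l.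
exact: (tail_sum_lt (fun k => pdeg (a i k))).
Qed.

Lemma row_end_le (i j : 'I_l) :
  (row_start mu a i j + pdeg (a i j) <= part_start mu i + mu i)%N.
Proof.
have [_ _ rowsum _] := aM; rewrite /row_start -addnA leq_add2l -rowsum.
exact: (tail_sum_le (fun k => pdeg (a i k))).
Qed.

Lemma in_cell_bounds i j p q k t x e : in_cell i j p q k t x e ->
  [/\ (k < pdeg (a i j))%N,
      (row_start mu a i j <= x < row_start mu a i j + pdeg (a i j))%N &
      (q <= pdeg (a i j))%N].
Proof. by move=> [r kpq _ xE _]; have := run_le_pdeg r; split; lia. Qed.

Lemma col_cell_part i j k (t : 'I_n) : t = (col_start mu a i j + k)%N :> nat ->
  (k < pdeg (a i j))%N -> part_of t = j.
Proof.
move=> tE kd; apply/eqP; rewrite part_of_eq tE.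
by have := col_end_le i j aM; rewrite /col_start; lia.
Qed.

Lemma col_cell_uniq i j k i' j' k' (t : 'I_n) :
  t = (col_start mu a i j + k)%N :> nat -> (k < pdeg (a i j))%N ->
  t = (col_start mu a i' j' + k')%N :> nat -> (k' < pdeg (a i' j'))%N ->
  [/\ i = i', j = j' & k = k'].
Proof.
move=> tE kd tE' kd'.
have jj' : j = j' by rewrite -(col_cell_part tE kd) (col_cell_part tE' kd').
rewrite -jj' in tE' kd' *.
have ii' : i = i'.
  have lt := col_start_lt mu a j.
  by case: (ltngtP i i') => [/lt|/lt|/val_inj //]; lia.
by rewrite -ii' in tE'; split=> //; lia.
Qed.

Lemma in_cell_col i j p q k (t : 'I_n) x e : in_cell i j p q k t x e ->
  part_of t = j.
Proof.
by move=> tc; have [kd _ _] := in_cell_bounds tc; have [_ _ tE _ _] := tc;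
  exact: col_cell_part tE kd.
Qed.

Lemma in_cell_row i j p q k t (x : 'I_n) e : in_cell i j p q k t x e ->
  part_of x = i.
Proof.
move=> tc; have [_ xb _] := in_cell_bounds tc.
apply/eqP; rewrite part_of_eq.
by have := row_end_le i j; move: xb; rewrite /row_start; lia.
Qed.

Lemma in_cell_exists (t : 'I_n) :
  exists (x : 'I_n) (e : F) i j p q k, in_cell i j p q k t x e.
Proof.
have [am a0 _ _] := aM; have [i bt] := col_cell_exists mu_n t aM.
set j := part_of t in bt; set k := (t - col_start mu a i j)%N.
have kd : (k < pdeg (a i j))%N by rewrite /k; lia.
have [p [q [r kpq]]] := runP (am i j) (a0 i j) kd; have qd := run_le_pdeg r.
have rn := row_end_le i j; have en := part_end_le mu_n i.
have xn : (row_start mu a i j + (pdeg (a i j) + k - (p + q)) < n)%N by lia.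
exists (Ordinal xn), (a i j)`_p, i, j, p, q, k; split=> //=; rewrite /k; lia.
Qed.

Lemma in_cell_uniq i j p q k i' j' p' q' k' (t : 'I_n) x x' e e' :
  in_cell i j p q k t x e -> in_cell i' j' p' q' k' t x' e' ->
  [/\ i = i', j = j', x = x' & e = e'].
Proof.
move=> tc tc'; have [kd _ _] := in_cell_bounds tc;
  have [kd' _ _] := in_cell_bounds tc'.
have [r kpq tE xE ->] := tc; have [r' kpq' tE' xE' ->] := tc'.
have [ii' jj' kk'] := col_cell_uniq tE kd tE' kd'.
rewrite -ii' -jj' -kk' in r' kpq' xE' *.
by have [pp' qq'] := run_uniq r r' kpq kpq'; rewrite -pp' -qq' in xE' *;
  split=> //; lia.
Qed.

(** Cells are disjoint as sets of columns, so column [t] meets only the block of [a i j], where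
    [v_polyE] locates the nonzero entry. *)
Lemma v_mxE i j p q k (t x y : 'I_n) e : in_cell i j p q k t x e ->
  v_mx n mu a y t = e *+ (y == x).
Proof.
move=> tc; have [kd xb qd] := in_cell_bounds tc.
have [r kpq tE xE ->] := tc; have [am a0 _ colsum] := aM.
have other i' j' (u : 'I_(pdeg (a i' j'))) : (i' != i) || (j' != j) ->
    (t == col_start mu a i' j' + u :> nat)%N = false.
  move=> ij'; apply/eqP => tE'; have [ii' jj' _] :=
    col_cell_uniq tE kd tE' (ltn_ord u).
  by rewrite ii' jj' !eqxx in ij'.
rewrite /v_mx summxE (bigD1 i) //= [X in _ + X]big1 => [|i' i'i]; last first.
  rewrite summxE big1 // => j' _; rewrite mxE big1 // => s _;
    rewrite big1 // => u _.
  by rewrite other ?i'i ?andbF.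
rewrite addr0 summxE (bigD1 j) //= [X in _ + X]big1 => [|j' j'j]; last first.
  rewrite mxE big1 // => s _; rewrite big1 // => u _.
  by rewrite other ?j'j ?orbT ?andbF.
have sd : (x - row_start mu a i j < pdeg (a i j))%N by lia.
rewrite addr0 mxE (bigD1 (Ordinal sd)) //= [X in _ + X]big1 => [|s sx].
  rewrite addr0 (bigD1 (Ordinal kd)) //= [X in _ + X]big1 => [|u uk].
    rewrite (v_polyE _ (a0 i j) r) //= addr0 -mulrnA mulnb.
    by congr (_ *+ nat_of_bool _); rewrite -val_eqE /=; lia.
  by rewrite tE eqn_add2l [k == _]eq_sym -[k]/(val (Ordinal kd)) val_eqE (negPf
    uk) andbF.
rewrite big1 // => u _; case: (nat_of_ord t =P _) => [tE'|_];
  last by rewrite andbF.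
have uk : u = k :> nat by lia.
rewrite (v_polyE _ (a0 i j) r) ?uk // -mulrnA mulnb.
rewrite (_ : _ && _ = false) //; apply/negP => /andP[sE yE].
by case/eqP: sx; apply/val_inj => /=; lia.
Qed.

(** Cells sharing a block of rows or of columns are arranged from lower left to upper right, and so
    are the runs inside a cell. An entry further right and not higher can therefore only continue
    the same run. *)
Lemma in_cell_same_run i j p q k i' j' p' q' k' (t x t' x' : 'I_n) e e' :
  in_cell i j p q k t x e -> in_cell i' j' p' q' k' t' x' e' ->
  (t < t')%N -> (x <= x')%N -> i = i' \/ j = j' ->
  [/\ i = i', j = j', p = p' & q = q'].
Proof.
move=> tc tc' tt' xx' ij.
have [tj xi] := (in_cell_col tc, in_cell_row tc).
have [tj' xi'] := (in_cell_col tc', in_cell_row tc').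
have [kd xb qd] := in_cell_bounds tc; have [kd' xb' qd'] := in_cell_bounds tc'.
have [r kpq tE xE eE] := tc; have [r' kpq' tE' xE' eE'] := tc'.
have jj' : (j <= j')%N by rewrite -tj -tj' part_of_mono // ltnW.
have ii' : (i <= i')%N by rewrite -xi -xi' part_of_mono.
have [iE jE] : i = i' /\ j = j'.
  case: ij => E; split=> //; rewrite -E in tE' tE xb' kd' *.
    by case: (ltngtP j j') jj' => [/(row_start_lt i)||/val_inj //]; lia.
  by case: (ltngtP i i') ii' => [/(col_start_lt mu a j)||/val_inj //]; lia.
rewrite -iE -jE in r' tE' xE'; split=> //.
  by case: (run_lt r r' kpq kpq'); lia.
by case: (run_lt r r' kpq kpq'); lia.
Qed.

Lemma v_mx_encodes : exists rho c,
  [/\ injective rho, forall t, c t != 0, compatible mu_n rho c,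
      encodes mu_n a rho c & v_mx n mu a = mono_mx rho c].
Proof.
have /fin_all_exists[rho /fin_all_exists[c cellP]] := in_cell_exists.
exists rho, c.
have rho_inj : injective rho.
  suff neq (s t : 'I_n) : (s < t)%N -> rho s != rho t.
    move=> s t st.
    by case: (ltngtP s t) => [/neq|/neq|/val_inj //]; rewrite st eqxx.
  (* Equal rows would put both entries in one run, where distinct columns have distinct rows. *)
  move=> st; apply/negP => /eqP rst.
  have [i [j [p [q [k sc]]]]] := cellP s;
    have [i' [j' [p' [q' [k' tc]]]]] := cellP t.
  have ii' : i = i' by rewrite -(in_cell_row sc) rst (in_cell_row tc).
  have [||_ jj' pp' qq'] := in_cell_same_run sc tc st; first by rewrite rst.
    by left.
  have [_ _ sE xE _] := sc; have [_ _ tE yE _] := tc.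
  by rewrite -ii' -jj' -pp' -qq' -rst in tE yE; lia.
have same (s t : 'I_n) : (s < t)%N -> (rho s < rho t)%N ->
    adjacent s t || adjacent (rho s) (rho t) ->
    exists i j p q k k',
      in_cell i j p q k s (rho s) (c s) /\ in_cell i j p q k' t (rho t) (c t).
  move=> st rst adj.
  have [i [j [p [q [k sc]]]]] := cellP s;
    have [i' [j' [p' [q' [k' tc]]]]] := cellP t.
  have ij : i = i' \/ j = j'.
    case/orP: adj => /andP[_ /eqP];
      first by rewrite (in_cell_col sc) (in_cell_col tc); right.
    by rewrite (in_cell_row sc) (in_cell_row tc); left.
  have [iE jE pE qE] := in_cell_same_run sc tc st (ltnW rst) ij.
  by exists i, j, p, q, k, k'; split=> //; rewrite iE jE pE qE.
have rhoP : compatible mu_n rho c.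
  move=> s t st rst adj; have [i [j [p [q [k [k' [sc tc]]]]]]] :=
    same s t st rst adj.
  have [_ _ sE xE ->] := sc; have [_ _ tE yE ->] := tc.
  rewrite /adjacent (in_cell_col sc) (in_cell_col tc) (in_cell_row sc)
    (in_cell_row tc) !eqxx !andbT.
  by case/orP: adj => /andP[/eqP ? _]; split=> //; apply/eqP; lia.
split=> //.
- by move=> t; have [i [j [p [q [k [[_ fp _ _] _ _ _ ->]]]]]] := cellP t.
- split=> t.
    move=> i0; have [i [j [p [q [k tc]]]]] := cellP t;
      rewrite (in_cell_row tc) (in_cell_col tc).
    have [kd _ _] := in_cell_bounds tc; have [_ _ tE _ _] := tc.
    have lt := col_start_lt mu a j.
    by case: (ltngtP i0 i) => [/lt|/lt|/val_inj ->]; lia.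
  have [i [j [p [q [k tc]]]]] := cellP t;
    rewrite (in_cell_row tc) (in_cell_col tc).
  have [[pq fp fq f0] kpq tE xE cE] := tc.
  rewrite /= tE addKn; have [st|nst] := boolP (step rho t).
    (* The column [s] before [t] lies in the same run, so [k] is strictly between [p] and [q], where
       the coefficients vanish. *)
    have /existsP[s /andP[ast art]] := st.
    have [/andP[/eqP ts _] /andP[/eqP rts _]] := (ast, art).
    have [|||i' [j' [p' [q' [k1 [k' [sc' tc']]]]]]] := same s t;
      rewrite ?ts ?rts ?ast //.
    have iE : i = i' by rewrite -(in_cell_row tc) (in_cell_row tc').
    have jE : j = j' by rewrite -(in_cell_col tc) (in_cell_col tc').
    have [_ kpq1 sE _ _] := sc'; have [r' kpq' tE' _ _] := tc'.
    rewrite -iE -jE in r' sE tE'.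
    have kE : k = k' by lia.
    rewrite -kE in kpq'.
    have [pE qE] := run_uniq r' (And4 pq fp fq f0) kpq' kpq.
    by apply: f0; lia.
  (* If [k] is beyond [p], the column before [t] belongs to the same run, with its entry one row
     higher, which makes [t] a step. *)
  have [kp|pk] := leqP k p; first by rewrite cE (_ : k = p) //; lia.
  case/negP: nst.
  have sn : (t.-1 < n)%N by have := ltn_ord t; lia.
  pose s := Ordinal sn; have ts : t = s.+1 :> nat by rewrite /=; lia.
  have sc' : in_cell i j p q k.-1 s
      (row_start mu a i j + (pdeg (a i j) + k.-1 - (p + q))) (c t).
    have qd := run_le_pdeg (And4 pq fp fq f0).
    by split=> //; rewrite /=; lia.
  have [i' [j' [p' [q' [k' scs]]]]] := cellP s.
  have [ii' _ xE' _] := in_cell_uniq scs sc'.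
  rewrite (stepP mu_n rho ts) /adjacent (in_cell_col sc') (in_cell_col tc).
  rewrite (in_cell_row tc) (in_cell_row scs) ii' !eqxx !andbT xE' ts eqxx /=.
  by have qd := run_le_pdeg (And4 pq fp fq f0); apply/eqP; lia.
apply/matrixP => y t; have [i [j [p [q [k tc]]]]] := cellP t.
by rewrite (v_mxE y tc) mxE.
Qed.

End Encode.

(** * The bijection *)

Lemma mono_mx_inj (F : finFieldType) (n : nat) (rho rho' : 'I_n -> 'I_n)
    (c c' : 'I_n -> F) : (forall t, c t != 0) ->
  mono_mx rho c = mono_mx rho' c' -> rho = rho' /\ c = c'.
Proof.
move=> c0 /matrixP vE.
have rhoE t : rho t = rho' t.
  have := vE (rho t) t; rewrite !mxE eqxx; case: eqP => // _ /eqP.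
  by rewrite (negPf (c0 t)).
split; apply: boolp.funext => t; first exact: rhoE.
by have := vE (rho t) t; rewrite !mxE -rhoE eqxx.
Qed.

Theorem theorem2 (F : finFieldType) (C : numClosedFieldType)
    (n l : nat) (mu : 'I_l -> nat) (psi : F -> C) (psi_mu : 'M[F]_n -> C) :
  (0 < n)%N ->
  composition n mu ->
  additive_character psi ->
  nontrivial_character psi ->
  is_psi_mu psi mu psi_mu ->
  set_bij (M_mu F mu) (N_mu psi_mu) (v_mx n mu).
Proof.
move=> _ [_ mu_n] psi_char psi_nt psi_muP; split.
- move=> a aM; have [rho [c [rho_inj c0 rhoP _ ->]]] := v_mx_encodes mu_n aM.
  exact: (compatible_N_mu (mu_n := mu_n) psi_muP).
- move=> a a'; rewrite !inE => aM aM' vE.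
  have [rho [c [rho_inj c0 rhoP enc va]]] := v_mx_encodes mu_n aM.
  have [rho' [c' [rho_inj' c0' rhoP' enc' va']]] := v_mx_encodes mu_n aM'.
  (* Equal matrices have the same rows and entries, so [a] and [a'] encode the same data. *)
  move: vE; rewrite va va' => /(mono_mx_inj c0)[rhoE cE].
  by rewrite -rhoE -cE in enc'; exact: (encodes_uniq aM aM' enc enc').
- move=> v vN; have [_ v_mono _] := vN.
  have [rho [c [rho_inj c0 vE]]] := mono_mxP v_mono; rewrite vE in vN *.
  have rhoP := N_mu_compatible (mu_n :=
    mu_n) psi_char psi_nt psi_muP rho_inj c0 vN.
  have aM := decode_M_mu rho_inj c0 rhoP; exists (decode mu_n rho c) => //.
  (* Both the given matrix and the one built from [decode] are encoded by [decode], hence they are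
     equal. *)
  have [rho' [c' [rho_inj' c0' rhoP' enc' ->]]] := v_mx_encodes mu_n aM.
  exact: (encodes_inj aM rho_inj' rho_inj c0' c0 rhoP' rhoP enc'
    (decode_encodes rho_inj rhoP)).
Qed.
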